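(* Let $\mathbf A\in\mathbb R^{n\times s}$ and let $1\le r<\min(n,s)$. Let $\mathbf p,\mathbf s,\overline{\mathbf p},\overline{\mathbf s}$ be row and column index vectors with selection matrices $\mathbf P,\mathbf S,\overline{\mathbf P},\overline{\mathbf S}$, let $\mathbf Q_c,\mathbf Q_r$ be the orthonormal factors of the selected columns and rows of $\mathbf A$, let $\mathcal P=\mathbf Q_c(\overline{\mathbf P}^{\mathrm T}\mathbf Q_c)^{\dagger}\overline{\mathbf P}^{\mathrm T}$ and $\mathcal S=\overline{\mathbf S}(\mathbf Q_r^{\mathrm T}\overline{\mathbf S})^{\dagger}\mathbf Q_r^{\mathrm T}$, and let $\mathbf U,\mathbf Y$ be the leading $r$ left and right singular vectors of $\mathbf A$, all as specified in the context (including the rank assumptions stated there). Set $$\eta_p=\|(\mathbf P^{\mathrm T}\mathbf U)^{-1}\|,\quad \eta_s=\|(\mathbf Y^{\mathrm T}\mathbf S)^{-1}\|,\quad \overline{\eta}_p=\|(\overline{\mathbf P}^{\mathrm T}\mathbf Q_c)^{\dagger}\|,\quad \overline{\eta}_s=\|(\mathbf Q_r^{\mathrm T}\overline{\mathbf S})^{\dagger}\|,$$ and let $\sigma_{r+1}$ be the $(r+1)$th singular value of $\mathbf A$. Then $$\|\mathbf A-\mathcal P\mathbf A\mathcal S\|\le \min\left\{\overline{\eta}_p\big(\eta_s+\eta_p\overline{\eta}_s\big),\ \overline{\eta}_s\big(\eta_p+\overline{\eta}_p\eta_s\big)\right\}\sigma_{r+1}.$$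
   Context: All matrices are real; $\|\cdot\|$ is the spectral norm; $^{\dagger}$ is the Moore–Penrose pseudoinverse; $\mathbf I_k$ is the $k\times k$ identity. For a list $\mathbf j$ of distinct indices, $\mathbf I_k(:,\mathbf j)$ is the matrix formed by the columns of $\mathbf I_k$ indexed by $\mathbf j$. Index vectors: $\mathbf p=[p_1,\dots,p_r]$ lists $r$ distinct row indices in $\{1,\dots,n\}$, and $\overline{\mathbf p}=[p_1,\dots,p_r,p_{r+1},\dots,p_{r+m_r}]$ extends it by $m_r\ge 0$ further distinct row indices. Likewise $\mathbf s=[s_1,\dots,s_r]$ lists $r$ distinct column indices in $\{1,\dots,s\}$ and $\overline{\mathbf s}=[s_1,\dots,s_r,s_{r+1},\dots,s_{r+m_c}]$ extends it by $m_c\ge 0$ further distinct column indices. Put $\mathbf P=\mathbf I_n(:,\mathbf p)\in\mathbb R^{n\times r}$, $\overline{\mathbf P}=\mathbf I_n(:,\overline{\mathbf p})\in\mathbb R^{n\times(r+m_r)}$, $\mathbf S=\mathbf I_s(:,\mathbf s)\in\mathbb R^{s\times r}$, $\overline{\mathbf S}=\mathbf I_s(:,\overline{\mathbf s})\in\mathbb R^{s\times(r+m_c)}$. Thus $\mathbf A\mathbf S$ consists of the selected columns and $\mathbf P^{\mathrm T}\mathbf A$ of the selected rows of $\mathbf A$. QR factors: $\mathbf A\mathbf S=\mathbf Q_c\mathbf R_c$ and $(\mathbf P^{\mathrm T}\mathbf A)^{\mathrm T}=\mathbf Q_r\mathbf R_r$ are thin QR factorizations, with $\mathbf Q_c\in\mathbb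 R^{n\times r}$ and $\mathbf Q_r\in\mathbb R^{s\times r}$ having orthonormal columns and $\mathbf R_c,\mathbf R_r\in\mathbb R^{r\times r}$ upper triangular. Standing assumptions: $\mathbf R_c$ and $\mathbf R_r$ are invertible; $\overline{\mathbf P}^{\mathrm T}\mathbf Q_c$ has full column rank $r$ and $\mathbf Q_r^{\mathrm T}\overline{\mathbf S}$ has full row rank $r$ (so that $\mathcal P$, acting from the left, and $\mathcal S$, acting from the right, are oblique projectors onto the span of the selected columns and of the selected rows, respectively). Singular vectors: $\mathbf U\in\mathbb R^{n\times r}$ and $\mathbf Y\in\mathbb R^{s\times r}$ are the matrices of the first $r$ left and right singular vectors of $\mathbf A$ (from a singular value decomposition with singular values in nonincreasing order). The $r\times r$ matrices $\mathbf P^{\mathrm T}\mathbf U$ and $\mathbf Y^{\mathrm T}\mathbf S$ are assumed invertible. *)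

(* Defs.v *)
From HB Require Import structures.
From mathcomp Require Export all_boot all_order all_algebra.
From mathcomp Require Export boolp classical_sets reals.

Set Implicit Arguments.
Unset Strict Implicit.
Unset Printing Implicit Defensive.

Import Order.TTheory GRing.Theory Num.Theory.
Local Open Scope classical_set_scope.
Local Open Scope ring_scope.

Section Defs.
Variable R : realType.

Definition norm2 n (x : 'cV[R]_n) : R := Num.sqrt (\sum_i x i 0 ^+ 2).

Definition spectral_norm m n (A : 'M[R]_(m, n)) : R :=
  sup [set norm2 (A *m x) | x in [set x : 'cV[R]_n | norm2 x <= 1]].

Lemma norm2_0 n : norm2 (0 : 'cV[R]_n) = 0.
Proof.
by rewrite /norm2 big1 ?sqrtr0 // => i _; rewrite mxE expr0n.
Qed.

(* In particular the supremum above is never the default value of [sup]. *)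
Lemma has_sup_spectral_norm m n (A : 'M[R]_(m, n)) :
  has_sup [set norm2 (A *m x) | x in [set x : 'cV[R]_n | norm2 x <= 1]].
Proof.
split; first by exists (norm2 (A *m 0)); exists 0 => //=; rewrite norm2_0.
exists (Num.sqrt (\sum_i (\sum_j `|A i j|) ^+ 2)) => _ [x /= x1 <-].
apply: ler_wsqrtr; apply: ler_sum => i _.
rewrite -real_normK ?num_real// lerXn2r ?nnegrE ?sumr_ge0//.
rewrite mxE; apply: le_trans (ler_norm_sum _ _ _) _.
apply: ler_sum => j _; rewrite normrM ler_piMr//.
apply: le_trans x1; rewrite /norm2 -sqrtr_sqr; apply: ler_wsqrtr.
by rewrite (bigD1 j)//= lerDl sumr_ge0// => k _; rewrite sqr_ge0.
Qed.

(* The four Penrose equations. *)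
Definition is_pinv m n (A : 'M[R]_(m, n)) (X : 'M[R]_(n, m)) : Prop :=
  [/\ A *m X *m A = A, X *m A *m X = X,
      (A *m X)^T = A *m X & (X *m A)^T = X *m A].

Definition pinv m n (A : 'M[R]_(m, n)) : 'M[R]_(n, m) := xget 0 (is_pinv A).

Lemma is_pinv_uniq m n (A : 'M[R]_(m, n)) X Y :
  is_pinv A X -> is_pinv A Y -> X = Y.
Proof.
move=> [AXA XAX sAX sXA] [AYA YAY sAY sYA].
have eAX : A *m X = A *m Y.
  by rewrite -sAX -{1}AYA -[A *m Y *m A *m X]mulmxA trmx_mul sAX sAY mulmxA AXA.
have eXA : X *m A = Y *m A.
  rewrite -sXA -{1}AYA.
  have -> : X *m (A *m Y *m A) = (X *m A) *m (Y *m A) by rewrite !mulmxA.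
  by rewrite trmx_mul sXA sYA -!mulmxA (mulmxA A X) AXA.
by rewrite -XAX eXA -mulmxA eAX mulmxA YAY.
Qed.

Lemma row_free_gram_unit m n (B : 'M[R]_(m, n)) :
  row_free B -> B *m B^T \in unitmx.
Proof.
move=> fB; rewrite -row_free_unit; apply/inj_row_free => v vBB.
apply/eqP; rewrite -(mulmx_free_eq0 v fB); apply/eqP.
have h : (v *m B) *m (v *m B)^T = 0 by rewrite trmx_mul mulmxA -(mulmxA v) vBB mul0mx.
apply/rowP => j; rewrite [RHS]mxE; apply/eqP; rewrite -sqrf_eq0.
have /matrixP/(_ 0 0) := h; rewrite !mxE => /eqP.
rewrite psumr_eq0; last by move=> i _; rewrite [_^T _ _]mxE -expr2 sqr_ge0.
by move=> /allP/(_ j (mem_index_enum _)); rewrite [_^T _ _]mxE -expr2 implyTb mxE.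
Qed.

Lemma pinvP m n (A : 'M[R]_(m, n)) : is_pinv A (pinv A).
Proof.
apply: xgetPex.
have : row_full (col_base A) by exact: col_base_full.
have : row_free (row_base A) by exact: row_base_free.
move: (col_base A) (row_base A) (esym (mulmx_base A)) => C B.
move: (\rank A) C B => k C B eA fB fC.
have uB : B *m B^T \in unitmx by exact: row_free_gram_unit.
have uC : C^T *m C \in unitmx.
  have := @row_free_gram_unit _ _ C^T; rewrite trmxK; apply.
  by rewrite /row_free mxrank_tr.
exists (B^T *m invmx (B *m B^T) *m invmx (C^T *m C) *m C^T).
set X := _ *m C^T.
have AX : A *m X = C *m invmx (C^T *m C) *m C^T.
  by rewrite eA /X !mulmxA -(mulmxA C B) mulmxK.
have XA : X *m A = B^T *m invmx (B *m B^T) *m B.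
  by rewrite eA /X -!mulmxA (mulmxA C^T C) mulKmx.
split.
- by rewrite AX {1}eA -!mulmxA (mulmxA C^T C) mulKmx// -eA.
- by rewrite XA /X -!mulmxA (mulmxA B B^T) mulKVmx.
- by rewrite AX !trmx_mul trmxK trmx_inv trmx_mul trmxK mulmxA.
- by rewrite XA !trmx_mul trmxK trmx_inv trmx_mul trmxK mulmxA.
Qed.

Definition orthonormal_cols m n (Q : 'M[R]_(m, n)) : Prop := Q^T *m Q = 1%:M.

Definition upper_triangular n (T : 'M[R]_n) : Prop :=
  forall i j : 'I_n, (j < i)%N -> T i j = 0.

Definition thin_qr m n (M Q : 'M[R]_(m, n)) (T : 'M[R]_n) : Prop :=
  [/\ orthonormal_cols Q, upper_triangular T & M = Q *m T].

(* Singular value decomposition with the min(n, s) leading singular vectors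
   (its factors are the first min(n, s) columns of the square orthogonal
   ones); the singular values sigma 0 0, sigma 0 1, ... are nonincreasing. *)
Definition is_svd n s (A : 'M[R]_(n, s)) (W : 'M[R]_(n, minn n s))
    (sigma : 'rV[R]_(minn n s)) (Z : 'M[R]_(s, minn n s)) : Prop :=
  [/\ orthonormal_cols W, orthonormal_cols Z,
      (forall k, 0 <= sigma 0 k),
      (forall k l : 'I_(minn n s), (k <= l)%N -> sigma 0 l <= sigma 0 k)
    & A = W *m diag_mx sigma *m Z^T].

Definition leading_cols m k r (hr : (r <= k)%N) (M : 'M[R]_(m, k)) :
  'M[R]_(m, r) := colsub (widen_ord hr) M.

Definition selection_mx n k (f : 'I_k -> 'I_n) : 'M[R]_(n, k) :=
  colsub f 1%:M.

End Defs.

Arguments selection_mx R {n k} f.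

(* Main.v *)
(**
Split A - calP A calS either as (A - calP A) + calP (A - A calS) or as
(A - A calS) + (A - calP A) calS.  Since calP fixes the selected columns A S,
and the oblique projector Pi = S (Y^T S)^-1 Y^T satisfies Y^T (1 - Pi) = 0,
A - calP A = (1 - calP) A (1 - Pi), where A stretches the range of 1 - Pi by at
most sigma_(r+1).  A nonzero idempotent E satisfies |1 - E| <= |E|, so
|A - calP A| <= etabar_p eta_s sigma_(r+1); the bound on A - A calS is the same
one applied to A^T.
*)
Require Import Defs.
From HB Require Import structures.
From mathcomp Require Import all_boot all_order all_algebra.
From mathcomp Require Import boolp classical_sets reals.
From mathcomp Require Import ring lra.

Set Implicit Arguments.
Unset Strict Implicit.
Unset Printing Implicit Defensive.

Import Order.TTheory GRing.Theory Num.Theory.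
Local Open Scope ring_scope.

(** * Inner product and Euclidean norm on column vectors *)

Section EuclideanNorm.
Variables (R : realType) (n : nat).
Implicit Types x y : 'cV[R]_n.

Definition dot x y : R := (x^T *m y) 0 0.

Lemma dotC x y : dot x y = dot y x.
Proof. by rewrite /dot -[x^T *m y]trmxK trmx_mul trmxK mxE. Qed.

Lemma dotDr x y z : dot x (y + z) = dot x y + dot x z.
Proof. by rewrite /dot mulmxDr mxE. Qed.

Lemma dotZr x a y : dot x (a *: y) = a * dot x y.
Proof. by rewrite /dot -scalemxAr mxE. Qed.

Lemma dotDl x y z : dot (x + y) z = dot x z + dot y z.
Proof. by rewrite !(dotC _ z) dotDr. Qed.

Lemma dotZl a x y : dot (a *: x) y = a * dot x y.
Proof. by rewrite !(dotC _ y) dotZr. Qed.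

Lemma dotxx x : dot x x = norm2 x ^+ 2.
Proof.
rewrite /norm2 sqr_sqrtr ?sumr_ge0// => [|i _]; last exact: sqr_ge0.
by rewrite /dot mxE; apply: eq_bigr => i _; rewrite mxE expr2.
Qed.

Lemma norm2_ge0 x : 0 <= norm2 x. Proof. exact: sqrtr_ge0. Qed.

Lemma norm2_eq0 x : norm2 x = 0 -> x = 0.
Proof.
move=> x0; have := dotxx x; rewrite x0 expr0n /dot mxE => /eqP.
rewrite psumr_eq0 => [/allP h|i _]; last by rewrite mxE -expr2 sqr_ge0.
apply/colP => i; have := h i (mem_index_enum _).
by rewrite !mxE -expr2 sqrf_eq0 => /eqP.
Qed.

Lemma norm2Z a x : norm2 (a *: x) = `|a| * norm2 x.
Proof.
apply/eqP; rewrite -(eqrXn2 (n := 2)) ?mulr_ge0 ?norm2_ge0//.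
by rewrite exprMn real_normK ?num_real// -!dotxx dotZl dotZr mulrA -expr2.
Qed.

Lemma ler_norm2 x (b : R) : 0 <= b -> dot x x <= b ^+ 2 -> norm2 x <= b.
Proof. by move=> b0; rewrite dotxx ler_pXn2r ?nnegrE ?norm2_ge0. Qed.

Lemma dot_le_norm2 x y : dot x y <= norm2 x * norm2 y.
Proof.
have [x0|x0] := eqVneq (norm2 x) 0.
  by rewrite (norm2_eq0 x0) /dot trmx0 mul0mx mxE mulr_ge0 ?norm2_ge0.
have [y0|y0] := eqVneq (norm2 y) 0.
  by rewrite (norm2_eq0 y0) /dot mulmx0 mxE mulr_ge0 ?norm2_ge0.
have xy_gt0 : 0 < norm2 x * norm2 y.
  by rewrite mulr_gt0// lt_neqAle eq_sym ?x0 ?y0 norm2_ge0.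
(* Cauchy-Schwarz comes from the nonnegative square of this combination: after expansion it is a
   positive multiple of [norm2 x * norm2 y - dot x y]. *)
pose z := norm2 y *: x + (- norm2 x) *: y.
have : 0 <= dot z z by rewrite dotxx sqr_ge0.
have -> : dot z z = 2 * (norm2 x * norm2 y * (norm2 x * norm2 y - dot x y)).
  by rewrite !(dotDl, dotDr, dotZl, dotZr) (dotC y x) !dotxx; ring.
by rewrite pmulr_rge0// pmulr_rge0// subr_ge0.
Qed.

Lemma ler_norm2D x y : norm2 (x + y) <= norm2 x + norm2 y.
Proof.
apply: ler_norm2; first by rewrite addr_ge0 ?norm2_ge0.
rewrite !(dotDl, dotDr) (dotC y x) !dotxx.
by have := dot_le_norm2 x y; nra.
Qed.

End EuclideanNorm.

Lemma dot_mulmxl (R : realType) m n (A : 'M[R]_(m, n)) x y :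
  dot (A *m x) y = dot x (A^T *m y).
Proof. by rewrite /dot trmx_mul mulmxA. Qed.

(** * The spectral norm: transposes, orthonormal factors, idempotents *)

Section SpectralNorm.
Variable R : realType.

Lemma spectral_norm_le m n (A : 'M[R]_(m, n)) (c : R) : 0 <= c ->
  (forall x, norm2 (A *m x) <= c * norm2 x) -> spectral_norm A <= c.
Proof.
move=> c0 Ac; apply: ge_sup; first by have [] := has_sup_spectral_norm A.
move=> _ [x /= x1 <-]; apply: le_trans (Ac x) _.
by rewrite -[leRHS]mulr1 ler_wpM2l.
Qed.

Lemma norm2_mulmx m n (A : 'M[R]_(m, n)) x :
  norm2 (A *m x) <= spectral_norm A * norm2 x.
Proof.
have [x0|x0] := eqVneq (norm2 x) 0.
  by rewrite (norm2_eq0 x0) mulmx0 !norm2_0 mulr0.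
have x_gt0 : 0 < norm2 x by rewrite lt_neqAle eq_sym x0 norm2_ge0.
rewrite -ler_pdivrMr//.
have : norm2 (A *m ((norm2 x)^-1 *: x)) <= spectral_norm A.
  apply: ub_le_sup; first by have [] := has_sup_spectral_norm A.
  exists ((norm2 x)^-1 *: x) => //=.
  by rewrite norm2Z ger0_norm ?invr_ge0 ?norm2_ge0// mulVf.
by rewrite -scalemxAr norm2Z ger0_norm ?invr_ge0 ?norm2_ge0// mulrC.
Qed.

Lemma spectral_norm_ge0 m n (A : 'M[R]_(m, n)) : 0 <= spectral_norm A.
Proof.
apply: ub_le_sup; first by have [] := has_sup_spectral_norm A.
by exists 0; rewrite /= ?mulmx0 norm2_0.
Qed.

Lemma spectral_normD m n (A B : 'M[R]_(m, n)) :
  spectral_norm (A + B) <= spectral_norm A + spectral_norm B.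
Proof.
apply: spectral_norm_le => [|x]; first by rewrite addr_ge0 ?spectral_norm_ge0.
rewrite mulmxDl mulrDl; apply: le_trans (ler_norm2D _ _) _.
by rewrite lerD ?norm2_mulmx.
Qed.

Lemma spectral_normM m n p (A : 'M[R]_(m, n)) (B : 'M[R]_(n, p)) :
  spectral_norm (A *m B) <= spectral_norm A * spectral_norm B.
Proof.
apply: spectral_norm_le => [|x]; first by rewrite mulr_ge0 ?spectral_norm_ge0.
rewrite -mulmxA -mulrA; apply: le_trans (norm2_mulmx _ _) _.
by rewrite ler_wpM2l ?spectral_norm_ge0 ?norm2_mulmx.
Qed.

(** By Cauchy-Schwarz, the square of [norm2 (A^T *m x)] equals [dot x (A *m (A^T *m x))], hence is
    at most [norm2 x * spectral_norm A * norm2 (A^T *m x)]; one factor then cancels. *)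
Lemma spectral_norm_tr_le m n (A : 'M[R]_(m, n)) :
  spectral_norm A^T <= spectral_norm A.
Proof.
apply: spectral_norm_le => [|x]; first exact: spectral_norm_ge0.
have [->|y0] := eqVneq (norm2 (A^T *m x)) 0.
  by rewrite mulr_ge0 ?spectral_norm_ge0 ?norm2_ge0.
have y_gt0 : 0 < norm2 (A^T *m x) by rewrite lt_neqAle eq_sym y0 norm2_ge0.
rewrite -(ler_pM2l y_gt0) -expr2 -dotxx dot_mulmxl trmxK.
apply: le_trans (dot_le_norm2 _ _) _.
rewrite [leRHS]mulrC mulrAC [leRHS]mulrC.
by rewrite ler_wpM2l ?norm2_ge0// norm2_mulmx.
Qed.

Lemma spectral_norm_tr m n (A : 'M[R]_(m, n)) :
  spectral_norm A^T = spectral_norm A.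
Proof.
by apply/le_anti; rewrite spectral_norm_tr_le -{1}[A]trmxK spectral_norm_tr_le.
Qed.

Lemma norm2_orthonormal m n (Q : 'M[R]_(m, n)) x :
  orthonormal_cols Q -> norm2 (Q *m x) = norm2 x.
Proof.
move=> oQ; apply/eqP; rewrite -(eqrXn2 (n := 2)) ?norm2_ge0//.
by rewrite -!dotxx dot_mulmxl mulmxA oQ mul1mx.
Qed.

Lemma spectral_norm_orthonormal m n (Q : 'M[R]_(m, n)) :
  orthonormal_cols Q -> spectral_norm Q <= 1.
Proof.
by move=> oQ; apply: spectral_norm_le => // x; rewrite norm2_orthonormal ?mul1r.
Qed.

Lemma norm2_orthonormal_tr m n (Q : 'M[R]_(m, n)) x :
  orthonormal_cols Q -> norm2 (Q^T *m x) <= norm2 x.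
Proof.
move=> oQ; apply: le_trans (norm2_mulmx _ _) _.
by rewrite ler_piMl ?norm2_ge0// spectral_norm_tr spectral_norm_orthonormal.
Qed.

(** Applying [P] preserves length and applying [Q^T] does not increase it. This strips the outer
    factors from each oblique projector, leaving the norm of its small core. *)
Lemma spectral_norm_sandwich m n p q (P : 'M[R]_(m, n)) (X : 'M[R]_(n, p))
    (Q : 'M[R]_(q, p)) :
  orthonormal_cols P -> orthonormal_cols Q ->
  spectral_norm (P *m X *m Q^T) <= spectral_norm X.
Proof.
move=> oP oQ; apply: spectral_norm_le => [|x]; first exact: spectral_norm_ge0.
rewrite -!mulmxA norm2_orthonormal//; apply: le_trans (norm2_mulmx _ _) _.
by rewrite ler_wpM2l ?spectral_norm_ge0 ?norm2_orthonormal_tr.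
Qed.

Lemma spectral_norm_idem_ge1 n (E : 'M[R]_n) :
  E *m E = E -> E != 0 -> 1 <= spectral_norm E.
Proof.
move=> EE E0; rewrite leNgt; apply: contra E0 => E1.
apply/eqP/matrixP => i j; rewrite [RHS]mxE.
(* [E] fixes each of its columns, so a norm below 1 would force every column to vanish. *)
have : norm2 (E *m delta_mx j 0) = 0.
  have := norm2_mulmx E (E *m delta_mx j (0 : 'I_1)); rewrite mulmxA EE.
  by have := norm2_ge0 (E *m delta_mx j (0 : 'I_1)); nra.
by move=> /norm2_eq0 /colP/(_ i); rewrite -colE !mxE.
Qed.

(* The components [u] and [v] of [x] along [E] and [1 - E] are rescaled so
   that their norms get exchanged: this preserves the norm of [u + v], and [E]
   sends the result to a vector of norm [norm2 v]. *)
Lemma spectral_norm_idemC n (E : 'M[R]_n) :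
  E *m E = E -> E != 0 -> spectral_norm (1%:M - E) <= spectral_norm E.
Proof.
move=> EE E0; apply: spectral_norm_le => [|x]; first exact: spectral_norm_ge0.
set u := E *m x; set v := _ *m x.
have xE : x = u + v by rewrite /u /v mulmxBl mul1mx addrC subrK.
have Eu : E *m u = u by rewrite /u mulmxA EE.
have Ev : E *m v = 0 by rewrite /v mulmxA mulmxBr mulmx1 EE subrr mul0mx.
have [v0|v0] := eqVneq (norm2 v) 0.
  by rewrite v0 mulr_ge0 ?spectral_norm_ge0 ?norm2_ge0.
(* If [u] vanishes no rescaling is possible; then [x = v], and the claim reduces to
   [1 <= spectral_norm E]. *)
have [u0|u0] := eqVneq (norm2 u) 0.
  rewrite xE (norm2_eq0 u0) add0r ler_peMl ?norm2_ge0//.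
  exact: spectral_norm_idem_ge1.
pose w := (norm2 v / norm2 u) *: u + (norm2 u / norm2 v) *: v.
have Ew : norm2 (E *m w) = norm2 v.
  rewrite mulmxDr -!scalemxAr Eu Ev scaler0 addr0 norm2Z.
  by rewrite ger0_norm ?divr_ge0 ?norm2_ge0// divfK.
have wx : norm2 w = norm2 x.
  apply/eqP; rewrite -(eqrXn2 (n := 2)) ?norm2_ge0// -!dotxx xE /w.
  rewrite !(dotDl, dotDr, dotZl, dotZr) (dotC v u) !dotxx; apply/eqP.
  by field; rewrite u0 v0.
by rewrite -Ew -wx norm2_mulmx.
Qed.

End SpectralNorm.

(** * Pseudoinverses, selection matrices and leading columns *)

Lemma is_pinv_tr (R : realType) m n (A : 'M[R]_(m, n)) X :
  is_pinv A X -> is_pinv A^T X^T.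
Proof.
move=> [AXA XAX sAX sXA].
by split; rewrite -!trmx_mul ?trmxK -?mulmxA ?sAX ?sXA// mulmxA ?AXA ?XAX.
Qed.

Lemma pinv_tr (R : realType) m n (A : 'M[R]_(m, n)) : pinv A^T = (pinv A)^T.
Proof. exact: is_pinv_uniq (pinvP _) (is_pinv_tr (pinvP A)). Qed.

(** Full column rank makes [A] cancellable on the left in the Penrose equation
    [A *m pinv A *m A = A]; the cancellation is carried out on transposes. *)
Lemma pinv_mulmx (R : realType) m n (A : 'M[R]_(m, n)) :
  \rank A = n -> pinv A *m A = 1%:M.
Proof.
move=> rA; have [AXA _ _ _] := pinvP A.
have fA : row_free A^T by rewrite /row_free mxrank_tr rA.
apply: trmx_inj; apply: (row_free_inj fA).
by rewrite -trmx_mul mulmxA AXA trmx1 mul1mx.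
Qed.

Lemma orthonormal_selection (R : realType) n k (f : 'I_k -> 'I_n) :
  injective f -> orthonormal_cols (selection_mx R f).
Proof.
move=> inj_f; apply/matrixP => i j.
by rewrite /selection_mx mulmx_colsub mulmx1 !mxE (inj_eq inj_f) eq_sym.
Qed.

Lemma leading_cols_orthonormal (R : realType) m k r (hr : (r <= k)%N)
    (M : 'M[R]_(m, k)) :
  orthonormal_cols M -> orthonormal_cols (leading_cols hr M).
Proof.
move=> oM; rewrite /orthonormal_cols /leading_cols mulmx_colsub trmx_mxsub.
by rewrite -/(rowsub _ _) mul_rowsub_mx oM; apply/matrixP => i j; rewrite !mxE.
Qed.

(** * One-sided projection errors from a singular value decomposition *)

Section Truncation.
Variables (R : realType) (n s k r : nat) (r_lt : (r < k)%N).
Variables (W : 'M[R]_(n, k)) (sigma : 'rV[R]_k) (Z : 'M[R]_(s, k)).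
Hypothesis oW : orthonormal_cols W.
Hypothesis oZ : orthonormal_cols Z.
Hypothesis sigma_ge0 : forall i, 0 <= sigma 0 i.
Hypothesis sigma_nincr :
  forall i j : 'I_k, (i <= j)%N -> sigma 0 j <= sigma 0 i.

Let A := W *m diag_mx sigma *m Z^T.
Let Y := leading_cols (ltnW r_lt) Z.

(** In the coordinates [Z^T *m x] the hypothesis kills the first [r] entries, and every other entry
    is scaled by at most the singular value at zero-based index [r], which is sigma_(r+1). *)
Lemma norm2_mul_trailing (x : 'cV[R]_s) : Y^T *m x = 0 ->
  norm2 (A *m x) <= sigma 0 (Ordinal r_lt) * norm2 x.
Proof.
move=> Yx0; rewrite /A -!mulmxA norm2_orthonormal//.
apply: (@le_trans _ _ (sigma 0 (Ordinal r_lt) * norm2 (Z^T *m x))); last first.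
  by rewrite ler_wpM2l ?norm2_orthonormal_tr.
set z := Z^T *m x.
have z0 (i : 'I_k) : (i < r)%N -> z i 0 = 0.
  move=> ir; have := congr1 (fun M : 'cV[R]_r => M (Ordinal ir) 0) Yx0.
  rewrite [RHS]mxE => <-; rewrite !mxE; apply: eq_bigr => j _; rewrite !mxE.
  by congr (Z _ _ * _); apply: val_inj.
apply: ler_norm2; first by rewrite mulr_ge0 ?norm2_ge0.
rewrite exprMn -!dotxx /dot !mxE mulr_sumr; apply: ler_sum => i _.
rewrite !mul_diag_mx !mxE -!expr2.
have [ir|ri] := ltnP i r.
  by have := z0 i ir; rewrite !mxE => ->; rewrite !mulr0 !expr0n/= mulr0.
by rewrite exprMn ler_wpM2r ?sqr_ge0// lerXn2r ?nnegrE// sigma_nincr.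
Qed.

(** Stated for any left inverse [X] of [P^T *m Q], so that it serves both [A] with its selected
    columns and [A^T] with its selected rows. *)
Lemma oblique_projection_error m (S : 'M[R]_(s, r)) (Q : 'M[R]_(n, r))
    (T : 'M[R]_r) (X : 'M[R]_(r, m)) (P : 'M[R]_(n, m)) :
  (0 < r)%N -> orthonormal_cols S -> orthonormal_cols Q -> orthonormal_cols P ->
  Y^T *m S \in unitmx -> A *m S = Q *m T -> X *m (P^T *m Q) = 1%:M ->
  spectral_norm (A - Q *m X *m P^T *m A) <=
    spectral_norm X * spectral_norm (invmx (Y^T *m S)) *
    sigma 0 (Ordinal r_lt).
Proof.
move=> r_gt0 oS oQ oP uYS AS XPQ.
(* [F *m G] is nonzero because [G *m (F *m G) *m F] is the identity, and [0 < r] provides a diagonal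
   entry where 1 would equal 0. *)
have idem_neq0 p (F : 'M[R]_(p, r)) (G : 'M[R]_(r, p)) :
    G *m F = 1%:M -> F *m G *m (F *m G) = F *m G /\ F *m G != 0.
  move=> GF; split; first by rewrite mulmxA -(mulmxA F G F) GF mulmx1.
  apply/eqP => FG0; have : G *m (F *m G) *m F = 1%:M by rewrite mulmxA GF mul1mx.
  rewrite FG0 mulmx0 mul0mx => /matrixP/(_ (Ordinal r_gt0) (Ordinal r_gt0)).
  by rewrite !mxE eqxx => /esym/eqP; rewrite oner_eq0.
have oY : orthonormal_cols Y by exact: leading_cols_orthonormal.
have [EE E0] : Q *m X *m P^T *m (Q *m X *m P^T) = Q *m X *m P^T /\
    Q *m X *m P^T != 0.
  by rewrite -(mulmxA Q X P^T); apply: idem_neq0; rewrite -mulmxA.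
set E := Q *m X *m P^T in EE E0 *.
(* [E] fixes the range of [Q], which contains the columns of [A *m S]. *)
have EAS : (1%:M - E) *m (A *m S) = 0.
  rewrite AS mulmxBl mul1mx {1}/E -!mulmxA (mulmxA P^T) (mulmxA X) XPQ mul1mx.
  by rewrite subrr.
pose F := S *m invmx (Y^T *m S) *m Y^T.
have [FF F0] : F *m F = F /\ F != 0.
  by rewrite /F -(mulmxA S _ Y^T); apply: idem_neq0; rewrite -mulmxA mulVmx.
have nE : spectral_norm (1%:M - E) <= spectral_norm X.
  exact: le_trans (spectral_norm_idemC EE E0) (spectral_norm_sandwich _ oQ oP).
have nF : spectral_norm (1%:M - F) <= spectral_norm (invmx (Y^T *m S)).
  exact: le_trans (spectral_norm_idemC FF F0) (spectral_norm_sandwich _ oS oY).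
have EAF : (1%:M - E) *m (A *m F) = 0.
  by rewrite /F -(mulmxA S) (mulmxA A S) (mulmxA (1%:M - E)) EAS mul0mx.
have -> : A - E *m A = (1%:M - E) *m (A *m (1%:M - F)).
  by rewrite (mulmxBr A) mulmx1 [RHS]mulmxBr EAF subr0 mulmxBl mul1mx.
apply: spectral_norm_le => [|x]; first by rewrite !mulr_ge0 ?spectral_norm_ge0.
rewrite -(mulmxA _ _ x) -(mulmxA A _ x).
apply: le_trans (norm2_mulmx _ _) _; rewrite -!mulrA.
apply: ler_pM; rewrite ?spectral_norm_ge0 ?norm2_ge0//.
(* The side condition holds because [Y^T *m F = Y^T], so [Y^T] annihilates the range of
   [1%:M - F]. *)
apply: le_trans (norm2_mul_trailing _) _.
  by rewrite mulmxA mulmxBr mulmx1 /F !mulmxA mulmxV// mul1mx subrr mul0mx.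
rewrite mulrCA ler_wpM2l//; apply: le_trans (norm2_mulmx _ _) _.
by rewrite ler_wpM2r ?norm2_ge0.
Qed.

End Truncation.

(** * Combining the row and column estimates *)

Theorem theorem2p4 (R : realType) (n s r mr mc : nat)
    (r_gt0 : (0 < r)%N) (r_lt : (r < minn n s)%N)
    (A : 'M[R]_(n, s))
    (pbar : 'I_(r + mr) -> 'I_n) (sbar : 'I_(r + mc) -> 'I_s)
    (Qc : 'M[R]_(n, r)) (Rc : 'M[R]_r)
    (Qr : 'M[R]_(s, r)) (Rr : 'M[R]_r)
    (W : 'M[R]_(n, minn n s)) (sigma : 'rV[R]_(minn n s))
    (Z : 'M[R]_(s, minn n s)) :
  let p := fun i : 'I_r => pbar (lshift mr i) in
  let q := fun i : 'I_r => sbar (lshift mc i) in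
  let P := selection_mx R p in
  let Pbar := selection_mx R pbar in
  let S := selection_mx R q in
  let Sbar := selection_mx R sbar in
  let U := leading_cols (ltnW r_lt) W in
  let Y := leading_cols (ltnW r_lt) Z in
  let sigma_r1 := sigma 0 (Ordinal r_lt) in
  injective pbar -> injective sbar ->
  thin_qr (A *m S) Qc Rc ->
  thin_qr (P^T *m A)^T Qr Rr ->
  Rc \in unitmx -> Rr \in unitmx ->
  \rank (Pbar^T *m Qc) = r ->
  \rank (Qr^T *m Sbar) = r ->
  is_svd A W sigma Z ->
  P^T *m U \in unitmx ->
  Y^T *m S \in unitmx ->
  let calP := Qc *m pinv (Pbar^T *m Qc) *m Pbar^T in
  let calS := Sbar *m pinv (Qr^T *m Sbar) *m Qr^T in
  let eta_p := spectral_norm (invmx (P^T *m U)) in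
  let eta_s := spectral_norm (invmx (Y^T *m S)) in
  let etabar_p := spectral_norm (pinv (Pbar^T *m Qc)) in
  let etabar_s := spectral_norm (pinv (Qr^T *m Sbar)) in
  spectral_norm (A - calP *m A *m calS) <=
    Num.min (etabar_p * (eta_s + eta_p * etabar_s))
            (etabar_s * (eta_p + etabar_p * eta_s)) * sigma_r1.
Proof.
move=> p q P Pbar S Sbar U Y sr inj_p inj_s [oQc _ AS] [oQr _ PA] _ _ rP rS.
move=> [oW oZ sg0 sgle eA] uPU uYS.
cbv zeta.
set calP := Qc *m _ *m _; set calS := Sbar *m _ *m _.
set eta_p := spectral_norm (invmx (P^T *m U)).
set eta_s := spectral_norm (invmx (Y^T *m S)).
set etabar_p := spectral_norm (pinv (Pbar^T *m Qc)).
set etabar_s := spectral_norm (pinv (Qr^T *m Sbar)).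
have oP : orthonormal_cols P.
  by apply: orthonormal_selection => i j /inj_p /lshift_inj.
have oS : orthonormal_cols S.
  by apply: orthonormal_selection => i j /inj_s /lshift_inj.
have oPbar : orthonormal_cols Pbar by exact: orthonormal_selection.
have oSbar : orthonormal_cols Sbar by exact: orthonormal_selection.
(* Exchanging [W] and [Z] gives a decomposition of [A^T] with the same singular values. *)
have eAT : A^T = Z *m diag_mx sigma *m W^T.
  by rewrite eA !trmx_mul trmxK tr_diag_mx mulmxA.
have rowE : spectral_norm (A - calP *m A) <= etabar_p * eta_s * sr.
  rewrite eA in AS *.
  apply: (oblique_projection_error oW oZ sg0 sgle r_gt0 oS oQc oPbar uYS AS).
  exact: pinv_mulmx.
have colE : spectral_norm (A - A *m calS) <= etabar_s * eta_p * sr.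
  have uUP : U^T *m P \in unitmx by rewrite -unitmx_tr trmx_mul trmxK.
  have PAT : A^T *m P = Qr *m Rr by rewrite -PA trmx_mul trmxK.
  have SQ : pinv (Sbar^T *m Qr) *m (Sbar^T *m Qr) = 1%:M.
    by apply: pinv_mulmx; rewrite -mxrank_tr trmx_mul trmxK.
  rewrite eAT in PAT.
  have := oblique_projection_error oZ oW sg0 sgle r_gt0 oP oQr oSbar uUP PAT SQ.
  (* The bound for [A^T] is transposed back: pseudoinverse and inverse commute with transposition,
     and the spectral norm is invariant under it. *)
  rewrite -eAT -[Sbar^T *m Qr]trmxK trmx_mul trmxK pinv_tr.
  rewrite -[U^T *m P]trmxK trmx_mul trmxK -trmx_inv !spectral_norm_tr.
  by rewrite -[leLHS]spectral_norm_tr linearB/= !trmx_mul !trmxK (mulmxA Sbar).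
have nP : spectral_norm calP <= etabar_p by exact: spectral_norm_sandwich.
have nS : spectral_norm calS <= etabar_s by exact: spectral_norm_sandwich.
have sr_ge0 : 0 <= sr by exact: sg0.
have [bp bs] : 0 <= etabar_p /\ 0 <= etabar_s by split; exact: spectral_norm_ge0.
(* As [sr] is nonnegative it distributes over the minimum, and each splitting of the error proves
   one of the two bounds. *)
rewrite minr_pMl// le_min; apply/andP; split.
- have -> : A - calP *m A *m calS = (A - calP *m A) + calP *m (A - A *m calS).
    by rewrite mulmxBr (mulmxA calP A) addrA subrK.
  have -> : etabar_p * (eta_s + eta_p * etabar_s) * sr =
    etabar_p * eta_s * sr + etabar_p * (etabar_s * eta_p * sr) by ring.
  apply: le_trans (spectral_normD _ _) (lerD rowE _).
  by apply: le_trans (spectral_normM _ _) _; rewrite ler_pM ?spectral_norm_ge0.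
- have -> : A - calP *m A *m calS = (A - A *m calS) + (A - calP *m A) *m calS.
    by rewrite mulmxBl addrA subrK.
  have -> : etabar_s * (eta_p + etabar_p * eta_s) * sr =
    etabar_s * eta_p * sr + etabar_p * eta_s * sr * etabar_s by ring.
  apply: le_trans (spectral_normD _ _) (lerD colE _).
  by apply: le_trans (spectral_normM _ _) _; rewrite ler_pM ?spectral_norm_ge0.
Qed.
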